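(* Let $n\ge 1$, let $\rho\in[0,1]$, and let $\mu$ be a probability measure on $\{-1,+1\}^n\times\{-1,+1\}^n$ such that, for $(\tau',\tau'')\sim\mu$ and every $m=1,\dots,n$, $$\mathbb{E}\big(\tau'_m\,\big|\,\tau'_1,\tau''_1,\dots,\tau'_{m-1},\tau''_{m-1}\big)=\mathbb{E}\big(\tau''_m\,\big|\,\tau'_1,\tau''_1,\dots,\tau'_{m-1},\tau''_{m-1}\big)=0,$$ and such that $\rho_{\max}(\mu)\le\rho$. Then for all functions $f,g:\{-1,+1\}^n\to\mathbb{C}$, $$\big|\langle g|\mu|f\rangle\big|\le \|f\|_{1+\rho}\,\|g\|_{1+\rho}.$$
   Context: Points of $\{-1,+1\}^n$ are written $\tau=(\tau_1,\dots,\tau_n)$. For a probability measure $\mu$ on $\{-1,+1\}^n\times\{-1,+1\}^n$ satisfying the displayed conditional-mean-zero condition, with $(\tau',\tau'')\sim\mu$, define $$\rho_{\max}(\mu)=\max_{m=1,\dots,n}\ \max\big|\mathbb{E}\big(\tau'_m\tau''_m\,\big|\,\tau'_1,\tau''_1,\dots,\tau'_{m-1},\tau''_{m-1}\big)\big|,$$ where the inner maximum is over all possible values (those of positive probability) of $(\tau'_1,\tau''_1,\dots,\tau'_{m-1},\tau''_{m-1})$. Notation: $\langle g|\mu|f\rangle=\mathbb{E}\big(f(\tau')g(\tau'')\big)$ where $(\tau',\tau'')\sim\mu$. For $p\ge1$, $\|f\|_p=\Big(2^{-n}\sum_{\tau\in\{-1,+1\}^n}|f(\tau)|^p\Big)^{1/p}$.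 *)

(* Defs.v *)
From HB Require Import structures.
From mathcomp Require Import all_boot all_order all_algebra.
From mathcomp Require Import complex.
From mathcomp Require Import reals exp.

Set Implicit Arguments.
Unset Strict Implicit.
Unset Printing Implicit Defensive.

Import Order.TTheory GRing.Theory Num.Theory.

Local Open Scope ring_scope.

(* Probability measures on a finite set, given by their point masses. *)
Record fdist (R : realType) (T : finType) := Fdist {
  mass :> T -> R;
  mass_ge0 : forall t, 0 <= mass t;
  mass_sum1 : \sum_(t : T) mass t = 1
}.

Definition Pr (R : realType) (T : finType) (mu : fdist R T) (A : {set T}) : R :=
  \sum_(t in A) mu t.

(* Elementary conditional expectation E(X | A); only used when Pr mu A > 0. *)
Definition condE (R : realType) (T : finType) (mu : fdist R T) (X : T -> R)
    (A : {set T}) : R :=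
  (\sum_(t in A) mu t * X t) / Pr mu A.

(* {-1,+1}^n, with the sign -1 encoded by true and +1 by false. *)
Definition cube (n : nat) := {ffun 'I_n -> bool}.

Definition spin (R : realType) (n : nat) (tau : cube n) (m : 'I_n) : R :=
  (-1) ^+ tau m.

(* The value of (tau'_1, tau''_1, ..., tau'_{m-1}, tau''_{m-1}); as m : 'I_n is
   counted from 0, these are the m coordinates of index i < m. *)
Definition past (n : nat) (m : 'I_n) (w : cube n * cube n) :
    {ffun 'I_m -> bool * bool} :=
  [ffun i : 'I_m => (w.1 (widen_ord (ltnW (ltn_ord m)) i),
                     w.2 (widen_ord (ltnW (ltn_ord m)) i))].

Definition past_event (n : nat) (m : 'I_n) (h : {ffun 'I_m -> bool * bool}) :
    {set cube n * cube n} :=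
  [set w | past m w == h].

Definition cond_mean_zero (R : realType) (n : nat)
    (mu : fdist R (cube n * cube n)%type) : Prop :=
  forall (m : 'I_n) (h : {ffun 'I_m -> bool * bool}),
    0 < Pr mu (past_event h) ->
    condE mu (fun w => spin R w.1 m) (past_event h) = 0 /\
    condE mu (fun w => spin R w.2 m) (past_event h) = 0.

(* All the terms are nonnegative and, when n > 0, both ranges are nonempty, so
   the default value 0 of the iterated maxima does not affect the result. *)
Definition rho_max (R : realType) (n : nat)
    (mu : fdist R (cube n * cube n)%type) : R :=
  \big[Num.max/0]_(m < n)
    \big[Num.max/0]_(h : {ffun 'I_m -> bool * bool} |
                       0 < Pr mu (past_event h))
      `|condE mu (fun w => spin R w.1 m * spin R w.2 m) (past_event h)|.

(* <g|mu|f>: there is no complex conjugation. *)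
Definition bracket (R : realType) (n : nat) (g : cube n -> R[i])
    (mu : fdist R (cube n * cube n)%type) (f : cube n -> R[i]) : R[i] :=
  \sum_(w : cube n * cube n) (mu w)%:C%C * (f w.1 * g w.2).

(* The norm of R[i] takes its (real) values in R[i]; this is its R-value. *)
Definition cabs (R : realType) (z : R[i]) : R := complex.Re `|z|.

Definition Lp_norm (R : realType) (n : nat) (p : R) (f : cube n -> R[i]) : R :=
  powR (2%:R ^- n * \sum_(tau : cube n) powR (cabs (f tau)) p) p^-1.

(* Main.v *)
Require Import Defs.
From mathcomp Require Import all_boot all_order all_algebra.
From mathcomp Require Import complex.
From mathcomp Require Import ring lra.
From mathcomp Require Import boolp reals topology normedtype derive realfun exp.

Set Implicit Arguments.
Unset Strict Implicit.
Unset Printing Implicit Defensive.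

Import Order.TTheory GRing.Theory Num.Theory numFieldNormedType.Exports.

Local Open Scope ring_scope.

(** Two-function hypercontractivity for a coupling whose successive increments
    have conditional mean zero.

    Put p = 1 + rho.  By the triangle inequality f and g may be replaced by
    their moduli F and G.  Average them in the L^p sense over the last
    coordinate, then over the one before it, and so on: [pavg p m] is one such
    average.  Every step preserves the L^p norms ([real_Lp_norm_pavg]), and
    after the last one both functions are constants, equal to their norms.  So
    it is enough that no step decreases the pairing E(F(tau') G(tau''))
    ([coord_step]).

    Condition on the past before coordinate m.  Functions of the coordinates up
    to m then become functions a + b tau'_m and a' + b' tau''_m of a single
    sign.  The first moments of the signs vanish and their product has
    conditional mean c with |c| <= rho, so the conditional pairing is
    a a' + c b b', and Cauchy-Schwarz gives
      a a' + c b b' <= sqrt (a^2 + rho b^2) sqrt (a'^2 + rho b'^2).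
    Each square root is at most the p-th power mean of the two values a + b and
    a - b: this is the two-point hypercontractive inequality of Bonami
    ([two_point_hypercontractivity]).

    The two-point inequality reduces by homogeneity to a = 1, b = t in [0, 1]:
      (1 + rho t^2)^(p/2) <= 1 + (p/2) rho t^2
                          <= ((1 + t)^p + (1 - t)^p) / 2.
    The first step is Bernoulli's inequality for the exponent p/2 <= 1.  In the
    second one both sides agree to first order at t = 0, and two
    differentiations reduce it to (1 + t)^(-s) + (1 - t)^(-s) >= 2, where
    s = 1 - rho >= 0, which holds because u^(-s) lies above its tangent line at
    u = 1. *)

(** * The two-point inequality *)

Section TwoPoint.
Variable R : realType.
Implicit Types (a b p q s t u x y rho : R).

(** Differentiability is asked on ]-1, 1[ rather than on [0, 1[ so that the
    derivative at the left end 0 is two-sided. *)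
Lemma ge0_of_is_derive (phi dphi : R -> R) :
  (forall x, -1 < x < 1 -> is_derive x (1 : R) phi (dphi x)) ->
  (forall x, 0 <= x < 1 -> 0 <= dphi x) -> phi 0 = 0 ->
  forall t, 0 <= t < 1 -> 0 <= phi t.
Proof.
move=> dphiP dphi_ge0 phi0 t /andP[t0 t1]; rewrite -[leLHS]phi0.
have in01 x : x \in `]0, t[ -> -1 < x < 1 /\ 0 <= x < 1.
  by rewrite in_itv /= => /andP[x0 xt]; split; lra.
apply: (@ger0_derive1_le_cc _ phi 0 t) => //; rewrite ?in_itv /= ?lexx ?t0 //.
- by move=> x /in01[/dphiP[]].
- move=> x /in01[xI /dphi_ge0]; rewrite derive1E.
  by have /@derive_val -> := dphiP _ xI.
- apply: derivable_within_continuous => x; rewrite in_itv /= => /andP[x0 xt].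
  by have [] := dphiP x; first lra.
Qed.

(** Weighted arithmetic-geometric inequality, in logarithmic form: with
    M = 1 + q u, the tangent bound ln x <= ln M + (x / M - 1) is used at
    x = 1 + u with weight q and at x = 1 with weight 1 - q; the linear terms
    then cancel because M is the weighted mean of the two points. *)
Lemma powR_bernoulli u q : 0 <= u -> 0 <= q <= 1 -> (1 + u) `^ q <= 1 + q * u.
Proof.
move=> u0 /andP[q0 q1].
have M0 : 0 < 1 + q * u by rewrite ltr_pwDl // mulr_ge0.
have z0 : 0 < 1 + u by lra.
rewrite /powR gt_eqF // -[leRHS]lnK ?posrE // ler_expR.
have lnB x y : 0 < x -> 0 < y -> ln x <= ln y + (x / y - 1).
  move=> x0 y0.
  rewrite -{1}[x](mulfVK (lt0r_neq0 y0)) lnM ?posrE ?divr_gt0 // addrC lerD2l.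
  have /le_ln1Dx : -1 < x / y - 1 by have := divr_gt0 x0 y0; lra.
  by rewrite addrC subrK.
have lnz := ler_wpM2l q0 (lnB _ _ z0 M0).
have ln1 : 0 <= (1 - q) * (ln (1 + q * u) + (1 / (1 + q * u) - 1)).
  by rewrite mulr_ge0 ?subr_ge0 // -[leLHS](@ln1 R); apply: lnB.
have /lt0r_neq0 Mn := M0.
apply: (le_trans lnz); rewrite -subr_ge0; apply: le_trans ln1 _.
by rewrite le_eqVlt; apply/orP; left; apply/eqP; field.
Qed.

(** The function u^(-s) = exp (- s ln u) lies above its tangent at u = 1,
    since exp y >= 1 + y and ln (1 + t) <= t. *)
Lemma powRN_tangent s t : 0 <= s -> -1 < t -> 1 - s * t <= (1 + t) `^ (- s).
Proof.
move=> s0 t1; rewrite /powR gt_eqF; last by lra.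
apply: le_trans (expR_ge1Dx _); rewrite lerD2l mulNr lerN2.
by rewrite ler_wpM2l // le_ln1Dx.
Qed.

Lemma is_derive_powR_comp (g : R -> R) (dg a x : R) :
  is_derive x (1 : R) g dg -> 0 < g x ->
  is_derive x (1 : R) (fun t => g t `^ a) (dg * (a * g x `^ (a - 1))).
Proof.
move=> H gx0.
have K := @is_derive1_comp _ (@powR R ^~ a) _ x _ _ (is_derive1_powR _ gx0) H.
by apply: is_derive_eq; rewrite mulrC.
Qed.

Lemma is_derive_powR_pm a x : -1 < x < 1 ->
  is_derive x (1 : R) (fun t => (1 + t) `^ a) (a * (1 + x) `^ (a - 1)) /\
  is_derive x (1 : R) (fun t => (1 - t) `^ a) (- (a * (1 - x) `^ (a - 1))).
Proof.
move=> /andP[x1 x2]; split.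
  have H : is_derive x (1 : R) (fun t => 1 + t) 1.
    by apply: is_derive_eq; rewrite add0r mulr1.
  by have := is_derive_powR_comp a H; rewrite mul1r; apply; lra.
have H : is_derive x (1 : R) (fun t => 1 - t) (-1).
  by apply: is_derive_eq; rewrite add0r mul1r.
by have := is_derive_powR_comp a H; rewrite mulN1r; apply; lra.
Qed.

(** The derivative in t is
    rho ((1 + t)^(rho - 1) + (1 - t)^(rho - 1) - 2), which is nonnegative by
    the tangent bounds at t and - t. *)
Lemma powR_odd_part rho t : 0 <= rho <= 1 -> 0 <= t < 1 ->
  0 <= (1 + t) `^ rho - (1 - t) `^ rho - 2 * rho * t.
Proof.
move=> /andP[r0 r1].
apply: (@ge0_of_is_derive
  (fun t => (1 + t) `^ rho - (1 - t) `^ rho - 2 * rho * t)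
  (fun t => rho * ((1 + t) `^ (rho - 1) + (1 - t) `^ (rho - 1) - 2))).
- move=> x xI; have [H1 H2] := is_derive_powR_pm rho xI.
  apply: is_derive_eq; rewrite /GRing.scale /=; ring.
- move=> x /andP[x0 x1]; rewrite mulr_ge0 //.
  have H1 := @powRN_tangent (1 - rho) x.
  have H2 := @powRN_tangent (1 - rho) (- x).
  rewrite !opprB in H1 H2.
  have := H1 ltac:(lra) ltac:(lra); have := H2 ltac:(lra) ltac:(lra). lra.
- by rewrite addr0 subr0 mulr0 subrr subrr.
Qed.

(** The derivative of the difference of the two sides is 1 + rho times the
    quantity of [powR_odd_part]. *)
Lemma powR_even_part_lt1 rho t : 0 <= rho <= 1 -> 0 <= t < 1 ->
  2 + (1 + rho) * rho * t ^+ 2 <= (1 + t) `^ (1 + rho) + (1 - t) `^ (1 + rho).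
Proof.
move=> r01 t01; rewrite -subr_ge0.
move: t t01; apply: (@ge0_of_is_derive
  (fun t => (1 + t) `^ (1 + rho) + (1 - t) `^ (1 + rho)
            - (2 + (1 + rho) * rho * t ^+ 2))
  (fun t => (1 + rho) * ((1 + t) `^ rho - (1 - t) `^ rho - 2 * rho * t))).
- move=> x xI; have [] := is_derive_powR_pm (1 + rho) xI.
  rewrite [1 + rho - 1]addrAC subrr add0r => H1 H2.
  apply: is_derive_eq; rewrite /GRing.scale /=; ring.
- move=> x xI; rewrite mulr_ge0 ?powR_odd_part //; lra.
- rewrite addr0 subr0 powR1; ring.
Qed.

(** At t = 1 the term (1 - t)^(1 + rho) is not differentiable from both sides,
    so the end point is obtained as a limit of t = 1 - d. *)
Lemma powR_even_part rho t : 0 <= rho <= 1 -> 0 <= t <= 1 ->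
  2 + (1 + rho) * rho * t ^+ 2 <= (1 + t) `^ (1 + rho) + (1 - t) `^ (1 + rho).
Proof.
move=> r01 /andP[t0]; rewrite le_eqVlt => /predU1P[->|t1]; last first.
  by apply: powR_even_part_lt1 => //; rewrite t0.
have /andP[r0 r1] := r01.
rewrite subrr powR0 ?addr0; last by apply: lt0r_neq0; lra.
rewrite expr1n mulr1; apply/ler_addgt0Pr => e e0.
(* The loss at t = 1 - d is d from (1 - t)^(1 + rho), bounded by 1 - t, plus at
   most 4 d from the quadratic term, hence at most e when 6 d <= e; capping e
   by 3 keeps d < 1. *)
pose d := Num.min e 3 / 6.
have [d0 d1 de] : [/\ 0 < d, d < 1 & 6 * d <= e].
  rewrite /d; case: (lerP e 3) => ?; split; lra.
have := @powR_even_part_lt1 rho (1 - d) r01 ltac:(lra).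
have : (1 + (1 - d)) `^ (1 + rho) <= (1 + 1) `^ (1 + rho).
  by apply: ge0_ler_powR; rewrite ?nnegrE; lra.
have : (1 - (1 - d)) `^ (1 + rho) <= d.
  by rewrite subKr; apply: ge1r_powR; lra.
have c0 : 0 <= (1 + rho) * rho by rewrite mulr_ge0 //; lra.
have c2 : (1 + rho) * rho <= 2 by nra.
have := mulr_ge0 c0 (sqr_ge0 d).
have : (1 + rho) * rho * d <= 2 * d by rewrite ler_wpM2r // ltW.
nra.
Qed.

(** The two-point inequality before taking roots; dividing by a^(1 + rho)
    leaves the normalised inequality in t = b / a, which is Bernoulli followed
    by [powR_even_part]. *)
Lemma two_point_power a b rho : 0 <= rho <= 1 -> `|b| <= a ->
  (a ^+ 2 + rho * b ^+ 2) `^ ((1 + rho) / 2) <=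
  ((a + b) `^ (1 + rho) + (a - b) `^ (1 + rho)) / 2.
Proof.
wlog b0 : b / 0 <= b => [H|] r01.
  case: (leP 0 b) => [/H|b0 ba]; first exact.
  have := H (- b) ltac:(lra) r01; rewrite normrN opprK sqrrN.
  by rewrite [X in _ <= X / 2]addrC; apply.
have /andP[r0 r1] := r01.
rewrite (ger0_norm b0) => ba; have a0 := le_trans b0 ba.
move: a0; rewrite le_eqVlt => /predU1P[a0|a0].
  have -> : b = 0 by lra.
  by rewrite -a0 expr0n mulr0 !addr0 subr0 powR0 ?divr_ge0 ?addr_ge0 ?powR_ge0 //;
    apply: lt0r_neq0; lra.
have a0' := lt0r_neq0 a0.
set t := b / a; have bE : b = a * t by rewrite /t mulrC divfK.
have t01 : 0 <= t <= 1 by rewrite /t divr_ge0 ?(ltW a0) //= ler_pdivrMr // mul1r.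
have -> : a ^+ 2 + rho * b ^+ 2 = a ^+ 2 * (1 + rho * t ^+ 2) by rewrite bE; ring.
have -> : a + b = a * (1 + t) by rewrite bE; ring.
have -> : a - b = a * (1 - t) by rewrite bE; ring.
clearbody t; have /andP[t0 t1] := t01.
rewrite !powRM ?subr_ge0 ?addr_ge0 ?sqr_ge0 ?mulr_ge0 ?sqr_ge0 ?(ltW a0) //.
rewrite -powRD ?a0' ?implybT // -splitr.
rewrite -mulrDr -mulrA ler_wpM2l ?powR_ge0 //.
apply: le_trans (powR_bernoulli _ _) _; [by rewrite mulr_ge0 ?sqr_ge0|lra|].
have := powR_even_part r01 t01; lra.
Qed.


Definition pmean p x y : R := ((x `^ p + y `^ p) / 2) `^ p^-1.

Lemma pmean_ge0 p x y : 0 <= pmean p x y.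
Proof. exact: powR_ge0. Qed.

Lemma powR_pmean p x y : p != 0 -> pmean p x y `^ p = (x `^ p + y `^ p) / 2.
Proof.
by move=> p0; rewrite -powRrM mulVf // powRr1 ?divr_ge0 ?addr_ge0 ?powR_ge0.
Qed.

(** Here x and y are the two values a + b and a - b, so (x + y) / 2 and
    (x - y) / 2 are the coefficients a and b. *)
Lemma two_point_hypercontractivity x y rho : 0 <= rho <= 1 -> 0 <= x -> 0 <= y ->
  ((x + y) / 2) ^+ 2 + rho * ((x - y) / 2) ^+ 2 <= pmean (1 + rho) x y ^+ 2.
Proof.
move=> r01 x0 y0; have /andP[r0 r1] := r01.
have p0 : 1 + rho != 0 by apply: lt0r_neq0; lra.
have := @two_point_power ((x + y) / 2) ((x - y) / 2) rho r01.
have -> : (x + y) / 2 + (x - y) / 2 = x by field.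
have -> : (x + y) / 2 - (x - y) / 2 = y by field.
have S0 : 0 <= ((x + y) / 2) ^+ 2 + rho * ((x - y) / 2) ^+ 2.
  by apply: addr_ge0; [|apply: mulr_ge0 => //]; exact: sqr_ge0.
have ab : `|(x - y) / 2| <= (x + y) / 2 by rewrite ler_norml; lra.
move/(_ ab); rewrite -powR_pmean // => H.
have q0 : (1 + rho) / 2 != 0 by apply: lt0r_neq0; lra.
have q'0 : 0 <= ((1 + rho) / 2)^-1 by rewrite invr_ge0; lra.
have := ge0_ler_powR q'0 _ _ H; rewrite !nnegrE !powR_ge0 => /(_ isT isT).
rewrite -[X in X <= _]powRrM divff // powRr1 // -[X in _ <= X]powRrM.
have -> : (1 + rho) * ((1 + rho) / 2)^-1 = 2%:R by field.
by rewrite powR_mulrn ?pmean_ge0.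
Qed.

(** The one-coordinate case of the theorem: Cauchy-Schwarz for the weights
    1 and rho, then the two-point inequality for each factor. *)
Lemma two_point_bilinear x y u v rho c : 0 <= rho <= 1 -> `|c| <= rho ->
  0 <= x -> 0 <= y -> 0 <= u -> 0 <= v ->
  (x + y) / 2 * ((u + v) / 2) + c * ((x - y) / 2 * ((u - v) / 2)) <=
  pmean (1 + rho) x y * pmean (1 + rho) u v.
Proof.
move=> r01 cr x0 y0 u0 v0; have /andP[r0 r1] := r01.
have a0 : 0 <= (x + y) / 2 by rewrite divr_ge0 ?addr_ge0.
have a'0 : 0 <= (u + v) / 2 by rewrite divr_ge0 ?addr_ge0.
have Hxy := two_point_hypercontractivity r01 x0 y0.
have Huv := two_point_hypercontractivity r01 u0 v0.
move: a0 a'0 Hxy Huv; set a := (x + y) / 2; set b := (x - y) / 2.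
set a' := (u + v) / 2; set b' := (u - v) / 2.
move: (pmean_ge0 (1 + rho) x y) (pmean_ge0 (1 + rho) u v).
set M := pmean _ x y; set M' := pmean _ u v => M0 M'0 a0 a'0 Hxy Huv.
clearbody a b a' b' M M'.
have cb : c * (b * b') <= rho * (`|b| * `|b'|).
  rewrite -normrM; apply: le_trans (ler_norm _) _; rewrite [leLHS]normrM.
  by rewrite ler_wpM2r.
apply: (@le_trans _ _ (a * a' + rho * (`|b| * `|b'|))); first by rewrite lerD2l.
rewrite -ler_sqr ?nnegrE ?addr_ge0 ?mulr_ge0 //.
rewrite exprMn.
apply: (@le_trans _ _ ((a ^+ 2 + rho * b ^+ 2) * (a' ^+ 2 + rho * b' ^+ 2)));
  last first.
  by apply: ler_pM => //;
    (apply: addr_ge0; [|apply: mulr_ge0 => //]; exact: sqr_ge0).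
rewrite -(real_normK (num_real b)) -(real_normK (num_real b')) -subr_ge0.
have -> : (a ^+ 2 + rho * `|b| ^+ 2) * (a' ^+ 2 + rho * `|b'| ^+ 2) -
   (a * a' + rho * (`|b| * `|b'|)) ^+ 2 = rho * (a * `|b'| - `|b| * a') ^+ 2.
  ring.
by rewrite mulr_ge0 ?sqr_ge0.
Qed.
End TwoPoint.

(** * Averaging over one coordinate of the cube *)

Section Cube.
Variables (R : realType) (n : nat).
Implicit Types (tau s t : cube n) (m i : 'I_n) (b : bool) (F G : cube n -> R).

Definition set_coord tau m b : cube n := [ffun i => if i == m then b else tau i].

Lemma set_coord_id tau m : set_coord tau m (tau m) = tau.
Proof. by apply/ffunP => i; rewrite ffunE; case: eqP => [->|]. Qed.

(** The two configurations obtained from tau by setting coordinate m are tau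
    and its flip at m, and flipping is an involution of the cube. *)
Lemma sum_set_coord F m :
  \sum_tau (F (set_coord tau m false) + F (set_coord tau m true)) =
  2 * \sum_tau F tau.
Proof.
pose flip tau := set_coord tau m (~~ tau m).
have flipK : involutive flip.
  move=> tau; apply/ffunP => i; rewrite !ffunE eqxx negbK.
  by case: eqP => [->|].
rewrite mulr_natl mulr2n [X in _ = _ + X](reindex_inj (inv_inj flipK)) -big_split.
apply: eq_bigr => tau _; rewrite -[in F tau](set_coord_id tau m) /flip /=.
by case: (tau m) => //=; rewrite addrC.
Qed.

Definition depends_below (k : nat) F :=
  forall s t, (forall i, (i < k)%N -> s i = t i) -> F s = F t.

Definition pavg p m F tau : R :=
  pmean p (F (set_coord tau m false)) (F (set_coord tau m true)).

Lemma depends_below_set_coord m F s t b : depends_below m.+1 F ->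
  (forall i, (i < m)%N -> s i = t i) -> F (set_coord s m b) = F (set_coord t m b).
Proof.
move=> HF st; apply: HF => i; rewrite ltnS leq_eqVlt !ffunE.
by have [//|ne /= /orP[/eqP/val_inj/eqP|/st//]] := eqVneq i m; rewrite (negPf ne).
Qed.

Lemma depends_below_pavg p m F :
  depends_below m.+1 F -> depends_below m (pavg p m F).
Proof.
by move=> HF s t st; rewrite /pavg !(depends_below_set_coord _ HF st).
Qed.

(** The norm on nonnegative real functions: [Lp_norm p f] is by definition
    [real_Lp_norm p] of the modulus of f. *)
Definition real_Lp_norm p F : R := (2 ^- n * \sum_tau F tau `^ p) `^ p^-1.

Lemma real_Lp_norm_pavg p m F : p != 0 ->
  real_Lp_norm p (pavg p m F) = real_Lp_norm p F.
Proof.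
move=> p0; rewrite /real_Lp_norm; congr ((_ * _) `^ _).
under eq_bigr do rewrite powR_pmean //.
rewrite -mulr_suml (sum_set_coord (fun tau => F tau `^ p)) mulrC mulKf //.
by rewrite pnatr_eq0.
Qed.

Lemma real_Lp_norm_const p c : p != 0 -> 0 <= c -> real_Lp_norm p (fun=> c) = c.
Proof.
move=> p0 c0; rewrite /real_Lp_norm sumr_const card_ffun card_bool card_ord.
rewrite -[c `^ p *+ _]mulr_natl natrX mulKf ?expf_neq0 ?pnatr_eq0 //.
by rewrite -powRrM divff // powRr1.
Qed.

(** Affine expansion in the sign of coordinate m, where [false] encodes the
    sign +1. *)
Lemma spin_decomp F m tau :
  F tau = (F (set_coord tau m false) + F (set_coord tau m true)) / 2
    + spin R tau m * ((F (set_coord tau m false) - F (set_coord tau m true)) / 2).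
Proof.
rewrite -[in LHS](set_coord_id tau m) /spin.
by case: (tau m); rewrite ?expr1 ?expr0; field.
Qed.

Lemma past_eq m (h : {ffun 'I_m -> bool * bool}) (w w0 : cube n * cube n) :
  w \in past_event h -> w0 \in past_event h ->
  (forall i, (i < m)%N -> w.1 i = w0.1 i) /\
  (forall i, (i < m)%N -> w.2 i = w0.2 i).
Proof.
rewrite !inE => /eqP <- /eqP /ffunP H.
have Hi i : (i < m)%N -> (w.1 i, w.2 i) = (w0.1 i, w0.2 i).
  move=> im; have := H (Ordinal im); rewrite !ffunE.
  by have -> : widen_ord (ltnW (ltn_ord m)) (Ordinal im) = i by apply: val_inj.
by split=> i /Hi[].
Qed.

(** * Conditioning on the past *)

Variable mu : fdist R (cube n * cube n)%type.

Lemma condE_le_rho_max m (h : {ffun 'I_m -> bool * bool}) :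
  0 < Pr mu (past_event h) ->
  `|condE mu (fun w => spin R w.1 m * spin R w.2 m) (past_event h)| <= rho_max mu.
Proof.
move=> Ph; apply: le_trans (le_bigmax _ _ m).
exact: (le_bigmax_cond _ (fun h => `|condE mu _ (past_event h)|) Ph).
Qed.

(** The pairing is split according to the past of coordinate m.  On one past
    event the four values of F and G at coordinate m are constants, so only the
    conditional moments of the two signs remain and [two_point_bilinear]
    applies. *)
Lemma coord_step rho m F G : 0 <= rho <= 1 ->
  cond_mean_zero mu -> rho_max mu <= rho ->
  (forall tau, 0 <= F tau) -> (forall tau, 0 <= G tau) ->
  depends_below m.+1 F -> depends_below m.+1 G ->
  \sum_w mu w * (F w.1 * G w.2) <=
  \sum_w mu w * (pavg (1 + rho) m F w.1 * pavg (1 + rho) m G w.2).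
Proof.
move=> r01 hmean hmax F0 G0 dF dG.
rewrite (partition_big (past m) predT) //= [leRHS](partition_big (past m) predT) //=.
apply: ler_sum => h _.
have toE (X : cube n * cube n -> R) :
    \sum_(w | past m w == h) X w = \sum_(w in past_event h) X w.
  by apply: eq_bigl => w; rewrite inE.
rewrite !toE.
have: 0 <= Pr mu (past_event h) by apply: sumr_ge0 => w _; apply: mass_ge0.
rewrite le_eqVlt => /predU1P[/esym P0|Pgt0].
  have mu0 w : w \in past_event h -> mu w = 0.
    by move/psumr_eq0P: P0; apply => // ? _; exact: mass_ge0.
  by rewrite !big1 // => w /mu0 ->; rewrite mul0r.
have [m1 m2] := hmean m h Pgt0.
have m3 := le_trans (condE_le_rho_max Pgt0) hmax.
have Pn0 := lt0r_neq0 Pgt0.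
have condP X c : condE mu X (past_event h) = c ->
    \sum_(w in past_event h) mu w * X w = c * Pr mu (past_event h).
  by move=> <-; rewrite /condE divfK.
have {}m1 := condP _ _ m1; have {}m2 := condP _ _ m2.
have {condP} := condP _ _ erefl.
move: m3; set c := condE mu _ _ => m3 m12; rewrite mul0r in m1 m2.
(* Values depending only on the past are read off at a reference point w0. *)
have [w0 w0h] : {w0 | w0 \in past_event h}.
  case: (pickP (mem (past_event h))) => [w0|none]; first by exists w0.
  by move: Pgt0; rewrite /Pr big_pred0 // ltxx.
pose x b := F (set_coord w0.1 m b); pose y b := G (set_coord w0.2 m b).
pose a := (x false + x true) / 2; pose b := (x false - x true) / 2.
pose a' := (y false + y true) / 2; pose b' := (y false - y true) / 2.
rewrite (eq_bigr (fun w => mu w * (a * a') + mu w * spin R w.1 m * (b * a')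
   + mu w * spin R w.2 m * (a * b')
   + mu w * (spin R w.1 m * spin R w.2 m) * (b * b'))); last first.
  move=> w wh; have [e1 e2] := past_eq wh w0h.
  rewrite [F _](spin_decomp F m) [G _](spin_decomp G m).
  rewrite !(depends_below_set_coord _ dF e1) !(depends_below_set_coord _ dG e2).
  rewrite /a /b /a' /b' /x /y; ring.
rewrite [leRHS](eq_bigr (fun w => mu w * (pmean (1 + rho) (x false) (x true)
   * pmean (1 + rho) (y false) (y true)))); last first.
  move=> w wh; have [e1 e2] := past_eq wh w0h; rewrite /pavg.
  by rewrite !(depends_below_set_coord _ dF e1) !(depends_below_set_coord _ dG e2).
rewrite !big_split /= -!mulr_suml m1 m2 m12 !mul0r !addr0.
rewrite -/(Pr mu (past_event h)) [c * _]mulrC -[X in _ + X]mulrA -mulrDr.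
rewrite ler_wpM2l ?(ltW Pgt0) //.
by apply: two_point_bilinear => //; [apply: F0|apply: F0|apply: G0|apply: G0].
Qed.

(** Induction on the number k of coordinates on which F and G depend: one step
    averages over coordinate k - 1, and at k = 0 both functions are constant. *)
Lemma pairing_le_real_Lp_norm rho k F G : 0 <= rho <= 1 ->
  cond_mean_zero mu -> rho_max mu <= rho -> (k <= n)%N ->
  (forall tau, 0 <= F tau) -> (forall tau, 0 <= G tau) ->
  depends_below k F -> depends_below k G ->
  \sum_w mu w * (F w.1 * G w.2) <=
  real_Lp_norm (1 + rho) F * real_Lp_norm (1 + rho) G.
Proof.
move=> r01 hmean hmax; have p0 : 1 + rho != 0 by apply: lt0r_neq0; lra.
elim: k F G => [|k IH] F G kn F0 G0 dF dG.
  pose t0 : cube n := [ffun=> false].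
  have FE : F = fun=> F t0 by apply/funext => t; apply: dF.
  have GE : G = fun=> G t0 by apply/funext => t; apply: dG.
  rewrite FE GE !real_Lp_norm_const // -mulr_suml.
  by have -> : \sum_w mu w = 1 := mass_sum1 mu; rewrite mul1r.
apply: le_trans (coord_step (m := Ordinal kn) r01 hmean hmax F0 G0 dF dG) _.
rewrite -(real_Lp_norm_pavg (Ordinal kn) F p0) -(real_Lp_norm_pavg (Ordinal kn) G p0).
apply: (IH _ _ (ltnW kn)).
- by move=> tau; apply: pmean_ge0.
- by move=> tau; apply: pmean_ge0.
- exact: (@depends_below_pavg _ (Ordinal kn)).
- exact: (@depends_below_pavg _ (Ordinal kn)).
Qed.

End Cube.

(** * Complex functions *)

Section Complex.
Variable R : realType.

Lemma cabsE (z : R[i]) : `|z| = (cabs z)%:C%C.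
Proof. by rewrite /cabs normc_def. Qed.

Lemma cabs_ge0 (z : R[i]) : 0 <= cabs z.
Proof. by rewrite /cabs normc_def sqrtr_ge0. Qed.

Lemma cabs_bracket n (mu : fdist R (cube n * cube n)%type) (f g : cube n -> R[i]) :
  cabs (bracket g mu f) <= \sum_w mu w * (cabs (f w.1) * cabs (g w.2)).
Proof.
rewrite -lecR -cabsE /bracket; apply: le_trans (ler_norm_sum _ _ _) _.
rewrite rmorph_sum /=; apply: ler_sum => w _.
rewrite !normrM !rmorphM /= -!cabsE ger0_norm ?lexx // ler0c.
exact: mass_ge0.
Qed.
End Complex.

Theorem theorem3p3 (R : realType) (n : nat) (hn : (0 < n)%N)
    (rho : R) (hrho : 0 <= rho <= 1)
    (mu : fdist R (cube n * cube n)%type)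
    (hmean : cond_mean_zero mu)
    (hmax : rho_max mu <= rho)
    (f g : cube n -> R[i]) :
  cabs (bracket g mu f) <= Lp_norm (1 + rho) f * Lp_norm (1 + rho) g.
Proof.
apply: le_trans (cabs_bracket mu f g) _.
apply: (@pairing_le_real_Lp_norm R n mu rho n
  (fun t => cabs (f t)) (fun t => cabs (g t))) => //;
  do ?[by move=> t; apply: cabs_ge0];
  by move=> s t st; congr (cabs (_ _)); apply/ffunP => i; apply: st.
Qed.
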